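(* Let $n\ge 2$, let $A\in\mathbb R^{n\times n}$ be nonsingular and $B\in\mathbb R^{n\times 1}$, and suppose $(A,B)$ is a controllable pair, i.e. $\mathrm{rank}\,[B\ \ AB\ \ \ldots\ \ A^{n-1}B]=n$. Define matrices $X_0:=B$ and $X_{i}:=[A^{-1}X_{i-1}\ \ B]$ for $i=1,\ldots,n-2$, and put $X:=X_{n-2}$. Let $$K_2:=\frac{\mathrm{null}((A^{-1}X)^{T})^{T}}{\mathrm{null}((A^{-1}X)^{T})^{T}B},\qquad K:=K_2A .$$ Then $K\in\mathbb R^{1\times n}$ is well defined and is a deadbeat gain for the system $\hat x^{+}=A\hat x+Bu$, that is, the matrix $A-BK$ is nilpotent.
   Context: For a matrix $M\in\mathbb R^{r\times n}$ whose null space has dimension $k$, $\mathrm{null}(M)$ denotes some (arbitrarily chosen) $n\times k$ matrix whose columns span the null space of $M$. $[P\ \ Q]$ denotes horizontal concatenation of matrices. Here $A^{-1}$ is the ordinary matrix inverse. ''Well defined'' means that $\mathrm{null}((A^{-1}X)^T)^TB$ is a nonzero scalar. *)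

(* Defs.v *)
From mathcomp Require Import all_boot all_order all_algebra.
From mathcomp Require Import reals.

Set Implicit Arguments.
Unset Strict Implicit.
Unset Printing Implicit Defensive.

Import Order.TTheory GRing.Theory Num.Theory.
Local Open Scope ring_scope.

(* The columns of this matrix are B, A B, ..., A^(n-1) B. *)
Definition controllability_mx (R : realType) (n : nat)
    (A : 'M[R]_n) (B : 'cV[R]_n) : 'M[R]_n :=
  \matrix_(i < n, j < n) (A ^+ j *m B) i 0.

Definition controllable (R : realType) (n : nat)
    (A : 'M[R]_n) (B : 'cV[R]_n) : Prop :=
  \rank (controllability_mx A B) = n.

(* The cast only rewrites the column count i.+1 + 1 of the concatenation to
   i.+2. *)
Fixpoint deadbeat_X (R : realType) (n : nat)
    (A : 'M[R]_n) (B : 'cV[R]_n) (i : nat) : 'M[R]_(n, i.+1) :=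
  if i is j.+1 then
    castmx (erefl n, addn1 j.+1) (row_mx (invmx A *m deadbeat_X A B j) B)
  else B.

(* kermx acts on row vectors, so the rows of kermx M^T span the transposes of
   the column vectors v such that M *m v = 0. *)
Definition nullity (R : realType) (r n : nat) (M : 'M[R]_(r, n)) : nat :=
  \rank (kermx M^T).

(* N is an admissible choice of null(M), whose choice is arbitrary: it has as
   many columns as the dimension of the null space of M, and they span it. *)
Definition is_null (R : realType) (r n k : nat)
    (M : 'M[R]_(r, n)) (N : 'M[R]_(n, k)) : Prop :=
  k = nullity M /\ (N^T == kermx M^T)%MS.

Lemma is_null_exists (R : realType) (r n : nat) (M : 'M[R]_(r, n)) :
  exists N : 'M[R]_(n, nullity M), is_null M N.
Proof.
exists (row_base (kermx M^T))^T; split=> //.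
by rewrite trmxK; apply/eqmxP/eq_row_base.
Qed.

Lemma is_nullP (R : realType) (r n k : nat)
    (M : 'M[R]_(r, n)) (N : 'M[R]_(n, k)) :
  is_null M N <->
  k = nullity M /\
  forall v : 'cV[R]_n, M *m v = 0 <-> exists c : 'cV[R]_k, v = N *m c.
Proof.
have kerP (v : 'cV[R]_n) : M *m v = 0 <-> (v^T <= kermx M^T)%MS.
  split=> [Mv|/sub_kermxP]; first by apply/sub_kermxP; rewrite -trmx_mul Mv trmx0.
  by rewrite -trmx_mul => /(congr1 trmx); rewrite trmxK trmx0.
have spanP (v : 'cV[R]_n) :
    (exists c : 'cV[R]_k, v = N *m c) <-> (v^T <= N^T)%MS.
  split=> [[c ->]|/submxP[c /(congr1 trmx)]]; first by rewrite trmx_mul submxMl.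
  by rewrite trmx_mul !trmxK => ->; exists c^T.
split=> -[k_eq H]; split=> //.
  by move=> v; rewrite kerP spanP (eqmxP H).
apply/andP; split; apply/row_subP => i.
  by rewrite -[row i _]trmxK; apply/kerP/H/spanP; rewrite trmxK row_sub.
by rewrite -[row i _]trmxK; apply/spanP/H/kerP; rewrite trmxK row_sub.
Qed.

Definition nilpotent_mx (R : realType) (n : nat) (M : 'M[R]_n) : Prop :=
  exists k : nat, M ^+ k = 0.

Definition deadbeat_gain (R : realType) (n : nat)
    (A : 'M[R]_n) (B : 'cV[R]_n) (K : 'rV[R]_n) : Prop :=
  nilpotent_mx (A - B *m K).

(* Main.v *)
(** Put [C = A^-1]. The columns of [X] are [C^(n-2) B, ..., C B, B], and by
    controllability [B, C B, ..., C^(n-1) B] is a basis. Hence [null((C X)^T)^T]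
    is the line of row vectors that vanish on [C B, ..., C^(n-1) B], and a
    nonzero one cannot vanish on [B]. Scaled so that [K2 B = 1], the closed loop
    [A - B K2 A = (1 - B K2) A] sends [C^(i+1) B] to [C^i B] for [0 < i < n] and
    kills [C B], so its [n]-th power kills the basis [C B, ..., C^n B]. *)
Require Import Defs.
From mathcomp Require Import all_boot all_order all_algebra.
From mathcomp Require Import reals.

Set Implicit Arguments.
Unset Strict Implicit.
Unset Printing Implicit Defensive.

Import Order.TTheory GRing.Theory Num.Theory.
Local Open Scope ring_scope.

Lemma mulmx_castmxr_eq0 (R : pzSemiRingType) (m n p p' : nat) (e : p = p')
    (W : 'M[R]_(m, n)) (Y : 'M[R]_(n, p)) :
  W *m castmx (erefl n, e) Y = 0 <-> W *m Y = 0.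
Proof. by case: p' / e; rewrite castmx_id. Qed.

(** Testing columns by left multiplication makes their order and the cast irrelevant. The induction
    keeps [W] general, since the block [C X_i] is tested by passing to [W C]. *)
Lemma mul_deadbeat_X_eq0 (R : realType) (m n : nat) (A : 'M[R]_n)
    (B : 'cV[R]_n) (i : nat) (W : 'M[R]_(m, n)) :
  W *m deadbeat_X A B i = 0 <->
  forall j, (j <= i)%N -> W *m (invmx A ^+ j *m B) = 0.
Proof.
elim: i W => [|i IHi] W.
  split=> [WB [|//] _|/(_ 0%N isT)]; first by rewrite expr0 mul1mx.
  by rewrite expr0 mul1mx.
rewrite /= mulmx_castmxr_eq0 mul_mx_row mulmxA.
have stepE j : W *m invmx A *m (invmx A ^+ j *m B) =
    W *m (invmx A ^+ j.+1 *m B).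
  by rewrite exprS -mulmxE !mulmxA.
split=> [/eqP | WB0].
  rewrite row_mx_eq0 => /andP[/eqP/IHi WC0 /eqP WB] [_|j lt_ji].
    by rewrite expr0 mul1mx.
  by rewrite -stepE; apply: WC0.
apply/eqP; rewrite row_mx_eq0; apply/andP; split; apply/eqP.
  by apply/IHi => j le_ji; rewrite stepE; apply: WB0.
by have := WB0 0%N isT; rewrite expr0 mul1mx.
Qed.

Lemma mulmx_expr_invmxK (R : comUnitRingType) (n j k : nat) (A : 'M[R]_n) :
  A \in unitmx -> invmx A ^+ (k + j) *m A ^+ j = invmx A ^+ k.
Proof.
move=> Au; elim: j => [|j IHj]; first by rewrite addn0 mulmx1.
by rewrite addnS exprSr exprS -!mulmxE mulmxA mulmxKV.
Qed.

(** As [C^(n-1) A^j B = C^(n-1-j) B], the matrix [W C^(n-1)] annihilates every column of the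
    controllability matrix, hence is zero; [C^(n-1)] is then cancelled. *)
Lemma controllable_inv_span (R : realType) (m n : nat) (A : 'M[R]_n)
    (B : 'cV[R]_n) (W : 'M[R]_(m, n)) :
  A \in unitmx -> controllable A B ->
  (forall i, (i < n)%N -> W *m (invmx A ^+ i *m B) = 0) -> W = 0.
Proof.
move=> Au ctrl WB0.
have ctrl_free : row_free (controllability_mx A B) by apply/eqP.
have WC0 : W *m invmx A ^+ n.-1 = 0.
  apply: (row_free_inj ctrl_free); rewrite mul0mx.
  apply/matrixP => i j; rewrite [RHS]mxE.
  have -> : (W *m invmx A ^+ n.-1 *m controllability_mx A B) i j =
            (W *m invmx A ^+ n.-1 *m (A ^+ j *m B)) i 0.
    by rewrite !mxE; apply: eq_bigr => k _; congr (_ * _); rewrite mxE.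
  have lt_jn := ltn_ord j.
  have le_jn : (j <= n.-1)%N by rewrite -ltnS (ltn_predK lt_jn).
  rewrite -(subnK le_jn) -mulmxA [X in W *m X]mulmxA mulmx_expr_invmxK //.
  by rewrite WB0 ?mxE // (leq_ltn_trans (leq_subr _ _)) // (ltn_predK lt_jn).
have := mulmx_expr_invmxK n.-1 0 Au; rewrite add0n expr0 => CA1.
by rewrite -[W]mulmx1 -[1%:M]CA1 mulmxA WC0 mul0mx.
Qed.

Lemma controllable_inv_span_shift (R : realType) (m n : nat) (A : 'M[R]_n)
    (B : 'cV[R]_n) (W : 'M[R]_(m, n)) :
  A \in unitmx -> controllable A B ->
  (forall i, (i < n)%N -> W *m (invmx A ^+ i.+1 *m B) = 0) -> W = 0.
Proof.
move=> Au ctrl WB0; rewrite -[W](mulmxKV Au).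
suff -> : W *m invmx A = 0 by rewrite mul0mx.
apply: (controllable_inv_span Au ctrl) => i lt_in.
by rewrite -(WB0 i lt_in) exprS -mulmxE !mulmxA.
Qed.

Lemma deadbeat_gain_of_annihilator (R : realType) (n : nat) (A : 'M[R]_n)
    (B : 'cV[R]_n) (K2 : 'rV[R]_n) :
  A \in unitmx -> controllable A B -> K2 *m B = 1%:M ->
  (forall i, (0 < i < n)%N -> K2 *m (invmx A ^+ i *m B) = 0) ->
  deadbeat_gain A B (K2 *m A).
Proof.
move=> Au ctrl K2B K2C; exists n; set D := A - _.
(* The factor [A] in [D = (1 - B K2) A] cancels one power of [C]. *)
have DE i : D *m (invmx A ^+ i.+1 *m B) =
    invmx A ^+ i *m B - B *m (K2 *m (invmx A ^+ i *m B)).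
  by rewrite exprS -mulmxE mulmxBl !mulmxA mulmxK // mulmxV // mul1mx.
have Dpow i : (i < n)%N -> D ^+ i.+1 *m (invmx A ^+ i.+1 *m B) = 0.
  elim: i => [|i IHi] lt_in; rewrite exprSr -mulmxE -mulmxA DE.
    by rewrite !expr0 !mul1mx K2B mulmx1 subrr.
  by rewrite K2C // mulmx0 subr0 IHi // ltnW.
apply: (controllable_inv_span_shift Au ctrl) => i lt_in.
have -> : D ^+ n = D ^+ (n - i.+1) *m D ^+ i.+1 by rewrite mulmxE -exprD subnK.
by rewrite -mulmxA Dpow // mulmx0.
Qed.

Theorem mainTheorem5 (R : realType) (n : nat) (A : 'M[R]_n) (B : 'cV[R]_n)
    (n_ge2 : (2 <= n)%N) (A_nonsing : A \in unitmx)
    (AB_controllable : controllable A B) :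
  let X := deadbeat_X A B (n - 2) in
  let M := (invmx A *m X)^T in
  nullity M = 1%N /\
  forall N : 'cV[R]_n, is_null M N ->
    let s := (N^T *m B) 0 0 in
    let K2 := s^-1 *: N^T in
    let K := K2 *m A in
    s != 0 /\ deadbeat_gain A B K.
Proof.
move=> X M.
have annE m (W : 'M[R]_(m, n)) : W *m M^T = 0 ->
    forall i, (0 < i < n)%N -> W *m (invmx A ^+ i *m B) = 0.
  (* [M^T] is [C X], so testing [X] against [W C] turns the exponents 0..n-2 into 1..n-1. *)
  rewrite trmxK mulmxA => /mul_deadbeat_X_eq0 WC0 [//|i] /= lt_in.
  rewrite -[RHS](WC0 i) ?exprS -?mulmxE ?mulmxA //.
  by rewrite leq_subRL // add2n.
have ann0 m (W : 'M[R]_(m, n)) : W *m M^T = 0 -> W *m B = 0 -> W = 0.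
  move=> /annE WM WB; apply: (controllable_inv_span A_nonsing AB_controllable).
  by case=> [_|i lt_in]; [rewrite expr0 mul1mx | apply: WM].
have nullM : nullity M = 1%N.
  apply/eqP; rewrite /nullity eqn_leq; apply/andP; split.
    (* Upper bound: by [ann0], right multiplication by [B] is injective on the kernel, and its
       values are scalars. *)
    rewrite -(mxrank_mul_ker (kermx M^T) B).
    suff -> : (kermx M^T :&: kermx B)%MS = 0 by rewrite mxrank0 addn0 rank_leq_col.
    by apply: ann0; apply/sub_kermxP; rewrite ?capmxSl ?capmxSr.
  (* Lower bound: [M^T] has only [n - 1] columns. *)
  rewrite mxrank_ker subn_gt0 (leq_ltn_trans (rank_leq_col _)) //.
  by rewrite -addn2 subnK.
split=> // N [_ N_ker] s K2.
have NM : N^T *m M^T = 0 by apply/sub_kermxP; rewrite (eqmxP N_ker).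
have s_neq0 : s != 0.
  (* If [s] vanished, [ann0] would give [N^T = 0], but [N^T] has rank 1. *)
  apply/eqP => s0; have NB : N^T *m B = 0.
    by rewrite [LHS]mx11_scalar -/s s0 raddf0.
  by have := nullM; rewrite /nullity -(eqmxP N_ker) (ann0 _ _ NM NB) mxrank0.
split=> //; apply: deadbeat_gain_of_annihilator => // [|i lt_in].
  by rewrite -scalemxAl [_ *m B]mx11_scalar -/s scale_scalar_mx mulVf.
by rewrite -scalemxAl annE // scaler0.
Qed.
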